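(* For every integer $d\ge 3$ there is $C_d>0$ such that for every positive integer $n$, $L_d(n)\le 2^{2^{2^{C_d n^{d-2}}}}$.
   Context: A $d$-dimensional array is an injective function $f:A_1\times\dots\times A_d\to\mathbb{R}$, where $A_1,\dots,A_d$ are non-empty subsets of $\mathbb{Z}$. If $|A_i|=n$ for each $i$, the array is said to have size $[n]^d$. A subarray of $f$ is a restriction of $f$ to $B_1\times\dots\times B_d$ with non-empty $B_i\subseteq A_i$. Write $[d]=\{1,\dots,d\}$. A $d$-dimensional array $f$ is lex-monotone if there exist a permutation $\tau$ of $[d]$ and a sign vector $s\in\{-1,1\}^d$ such that, for all $\mathbf{x},\mathbf{y}$ in the domain of $f$, $f(\mathbf{x})<f(\mathbf{y})$ if and only if the vector $(s_{\tau(i)}x_{\tau(i)})_{i\in[d]}$ is smaller in lexicographic order than the vector $(s_{\tau(i)}y_{\tau(i)})_{i\in[d]}$, that is, there is $i\in[d]$ such that $s_{\tau(j)}x_{\tau(j)}=s_{\tau(j)}y_{\tau(j)}$ for every $j<i$ and $s_{\tau(i)}x_{\tau(i)}<s_{\tau(i)}y_{\tau(i)}$. $L_d(n)$ denotes the smallest $N$ such that every $d$-dimensional array on $[N]^d$ contains a lex-monotone $d$-dimensional subarray of size $[n]^d$. *)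

(* Defs.v *)
From mathcomp Require Import all_boot all_order all_algebra all_fingroup.
From mathcomp Require Import all_classical all_reals all_analysis.

Set Implicit Arguments.
Unset Strict Implicit.
Unset Printing Implicit Defensive.

Import Order.TTheory GRing.Theory Num.Theory.
Local Open Scope classical_set_scope.
Local Open Scope ring_scope.

(* Coordinates are indexed by 'I_d = {0, ..., d-1} instead of {1, ..., d}. *)
Definition box (d : nat) (A : 'I_d -> set int) : set {ffun 'I_d -> int} :=
  [set x | forall i, A i (x i)].

(* The function is total, but its values outside the domain [box (sides f)]
   are irrelevant: no definition below looks at them. *)
Record array (R : realType) (d : nat) := Array {
  sides : 'I_d -> set int;
  array_fun :> {ffun 'I_d -> int} -> R;
  sides_nonempty : forall i, sides i !=set0;
  array_inj : {in box sides &, injective array_fun}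
}.

Definition has_size (R : realType) (d : nat) (f : array R d) (n : nat) : Prop :=
  forall i, (sides f i #= `I_n)%card.

Definition subarray (R : realType) (d : nat) (g f : array R d) : Prop :=
  (forall i, sides g i `<=` sides f i) /\ {in box (sides g), g =1 f}.

Definition lex_lt (d : nat) (u v : 'I_d -> int) : Prop :=
  exists i : 'I_d, (forall j : 'I_d, (j < i)%N -> u j = v j) /\ u i < v i.

Definition lex_monotone (R : realType) (d : nat) (f : array R d) : Prop :=
  exists (tau : 'S_d) (s : 'I_d -> int),
    (forall i, s i = -1 \/ s i = 1) /\
    {in box (sides f) &, forall x y,
       f x < f y <-> lex_lt (fun i => s (tau i) * x (tau i))
                            (fun i => s (tau i) * y (tau i))}.

Definition array_on (R : realType) (d : nat) (f : array R d) (N : nat) : Prop :=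
  forall i, sides f i = [set a : int | 1 <= a <= N%:Z].

(* N must be positive: there is no array on [0]^d, since sides are non-empty,
   so the universal statement would hold vacuously for N = 0. *)
Definition lex_unavoidable (R : realType) (d n N : nat) : Prop :=
  (0 < N)%N /\
  forall f : array R d, array_on f N ->
    exists g : array R d, [/\ subarray g f, has_size g n & lex_monotone g].

(* [is_L R d n N] means L_d(n) = N. *)
Definition is_L (R : realType) (d n N : nat) : Prop :=
  lex_unavoidable R d n N /\
  forall M : nat, lex_unavoidable R d n M -> (N <= M)%N.

(* Main.v *)
Require Import Defs.
From mathcomp Require Import all_boot all_order all_algebra all_fingroup.
From mathcomp Require Import all_classical all_reals all_analysis.
From mathcomp Require Import zify.
Import Order.TTheory GRing.Theory Num.Theory.

(** Points are functions [x : I -> nat] on a finite set [I] of [d] coordinates,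
and a subgrid is given by a list [G i] of [n] values for each coordinate. The
proof finds a monotone subarray, whose lines in each direction all increase or
all decrease, and then a lex-monotone subarray inside it.

Monotone subarrays cost only two exponentials: for some [c] depending on [d], an
array of side [2 ^ (2 ^ ((c * m) ^ c))] contains a monotone one of side [m]. Whether [f] goes up from [x] to [x'] is a
two-colouring of the pairs of points that differ in one coordinate. Asking for
a subgrid on which this colouring is constant in each direction, and adding one
coordinate at a time, would make the exponentials pile up. Instead
[end_hom_grid] only asks, as Erdos and Rado did, that the colour of a pair be
determined by its lower point and its direction. This needs few values, and turns
the colouring of pairs into a colouring of points with [2 ^ d] colours, for which
[monochromatic_grid] is a pigeonhole argument that costs one exponential. The
two are combined in [homogeneous_directions].

After some coordinates are reversed, the monotone subarray increases in all of
them. By [dominating_coordinate], every cube of side [2 * d + 1] has a direction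
[i] such that crossing the whole cube in direction [i] outweighs suitable unit
steps in all other directions together. Averaging over the cells of a large grid
([dense_line]) makes [i] dominate in this way at many places of a single line in
direction [i]. Above each of these places lies an array with one coordinate less,
to which induction applies; the places at which the induction returns the same
subgrid form, together with this subgrid, a lex-monotone array in which [i] comes
first ([extend_lex_family]). The induction therefore carries a family of [T]
candidate subgrids, one of which works for every increasing array, and has to
control [T] as well as the side [N]. With [C] depending only on [d], one more
dimension replaces [T] by at most [(C * T) ^ (n + d + 1) * n ^ d] and [N] by
[C * n * T * N]. Starting from [T = 1] and [N = n] in dimension one, this gives
[T <= 2 ^ (A * n ^ (d - 1))] and [N <= 2 ^ (A * n ^ (d - 2))] for [d >= 3]
([lex_family_exists]). Taking this [N] for the side [m] of the monotone subarray
gives the triple exponential ([tower_bound]). *)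

Set Implicit Arguments.
Unset Strict Implicit.
Unset Printing Implicit Defensive.

(** * Pigeonhole principles *)

Lemma pigeonhole (A : Type) (T : finType) (h : A -> T) (s : seq A) (r : nat) :
  r * #|T| < size s -> exists t, r < count (fun x => h x == t) s.
Proof.
move=> lt_s; apply: contrapT => no_t.
suff: size s <= r * #|T| by rewrite leqNgt lt_s.
have -> : size s = \sum_t count (fun x => h x == t) s.
  elim: s {lt_s no_t} => [|x s IHs] /=; first by rewrite big1.
  rewrite big_split /= -IHs -add1n; congr (_ + _).
  by rewrite (bigD1 (h x)) //= eqxx big1 // => t /negbTE; rewrite eq_sym => ->.
rewrite mulnC -sum_nat_const; apply: leq_sum => t _.
by rewrite leqNgt; apply/negP => lt_t; apply: no_t; exists t.
Qed.

Lemma pigeonhole_subseq (A : eqType) (T : finType) (h : A -> T) (s : seq A)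
    (r : nat) :
  0 < #|T| -> r * #|T| <= size s ->
  exists t s', [/\ subseq s' s, size s' = r & {in s', forall x, h x = t}].
Proof.
move=> T0 le_s.
have [t le_t] : exists t, r <= count (fun x => h x == t) s.
  case: r le_s => [|r] le_s; first by have /card_gt0P[t _] := T0; exists t.
  have [] := @pigeonhole _ _ h s r; last by move=> t lt_t; exists t.
  by apply: leq_trans le_s; rewrite ltn_pmul2r.
exists t, (take r [seq x <- s | h x == t]); split.
- exact: subseq_trans (take_subseq _ _) (filter_subseq _ _).
- by rewrite size_takel // size_filter.
- by move=> x /mem_take; rewrite mem_filter => /andP[/eqP].
Qed.

(** Erdos and Rado: if the colour of a pair depends only on its smaller element,
the edges are coloured by vertices; only the class of the first element has to
be large at each step, so that one exponential suffices. *)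
Lemma end_homogeneous (C : finType) (q : nat) (chi : nat -> nat -> C) :
  1 < q -> #|C| <= q -> forall (K : nat) (s : seq nat),
  sorted ltn s -> q ^ K <= size s ->
  exists s', [/\ subseq s' s, size s' = K &
    {in s' & &, forall a b b', a < b -> a < b' -> chi a b = chi a b'}].
Proof.
move=> q1 Cq; elim=> [|K IHK] [|a s] /= ss le_s.
- by exists [::].
- by exists [::]; split.
- by move: le_s; rewrite leqNgt expn_gt0 (ltnW q1).
have [t lt_t] : exists t, q ^ K - 1 < count (fun x => chi a x == t) s.
  apply: pigeonhole.
  have qK : 0 < q ^ K by rewrite expn_gt0 (ltnW q1).
  apply: (@leq_ltn_trans ((q ^ K - 1) * q)); first by rewrite leq_mul2l Cq orbT.
  have := leq_pmull q qK; rewrite mulnBl mul1n -expnSr.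
  by move: (q ^ K.+1) le_s => /= A; lia.
have [||s' [sub_s' sz_s' hom_s']] := IHK [seq x <- s | chi a x == t].
- by rewrite sorted_filter //; [exact: ltn_trans|exact: path_sorted ss].
- by rewrite size_filter; lia.
have lt_a x : x \in s' -> a < x.
  move=> /(mem_subseq sub_s'); rewrite mem_filter => /andP[_ xs].
  by have /allP := order_path_min ltn_trans ss; exact.
have col_a x : x \in s' -> chi a x = t.
  by move=> /(mem_subseq sub_s'); rewrite mem_filter => /andP[/eqP].
exists (a :: s'); split.
- by rewrite /= eqxx; apply: subseq_trans sub_s' _; exact: filter_subseq.
- by rewrite /= sz_s'.
move=> b c c'; rewrite !inE => /orP[/eqP->|bs'] /orP[/eqP->|cs']
  /orP[/eqP->|cs''] //; rewrite ?ltnn // => bc bc'.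
- by rewrite !col_a.
- by have := lt_a _ bs'; rewrite ltnNge ltnW.
- by have := lt_a _ bs'; rewrite ltnNge ltnW.
- exact: hom_s'.
Qed.

(** * Homogeneous subgrids *)

Section Grids.
Variable I : finType.
Implicit Types (x y : I -> nat) (S : {set I}) (G : I -> seq nat).

Definition upd y i z : I -> nat := fun j => if j == i then z else y j.

(** The coordinates outside [S] are frozen at their values in [y]. *)
Definition grid S G y x : Prop :=
  forall i, if i \in S then is_true (x i \in G i) else x i = y i.

Definition sides_in (n N : nat) G : Prop :=
  forall i, [/\ sorted ltn (G i), size (G i) = n & all (fun a => a < N) (G i)].

Lemma sides_in_code n N G : sides_in n N G ->
  exists c : {ffun I -> n.-tuple 'I_N}, forall i, G i = map val (c i).
Proof.
move=> GP.
have /choice[c cP] : forall i, exists t : n.-tuple 'I_N, G i = map val t.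
  move=> i; have [_ /eqP sz lt] := GP i.
  have [t tE] : exists t : seq 'I_N, G i = map val t.
    elim: (G i) lt {sz} => [|a s IHs] /=; first by exists [::].
    by move=> /andP[aN /IHs[t ->]]; exists (Ordinal aN :: t).
  have szt : size t == n by rewrite -(size_map val t) -tE.
  by exists (Tuple szt).
by exists [ffun i => c i] => i; rewrite ffunE.
Qed.

Lemma sides_inW n N N' G : N <= N' -> sides_in n N G -> sides_in n N' G.
Proof.
move=> NN' GP i; have [? ? lt] := GP i; split=> //.
by apply: sub_all lt => a /= aN; apply: leq_trans NN'.
Qed.

Lemma sides_in_iota n N : n <= N -> sides_in n N (fun=> iota 0 n).
Proof.
move=> nN i; split; rewrite ?size_iota ?iota_ltn_sorted //.
by apply/allP => a; rewrite mem_iota => /andP[_ an]; exact: leq_trans an nN.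
Qed.

(** The pigeonhole step shared by both constructions below: there are at most
[(N ^ n) ^ #|I|] choices of [G], so one of them serves many [z] at once. *)
Lemma uniform_grid n N (P : nat -> (I -> seq nat) -> Prop) (r : nat) :
  (forall z, exists G, sides_in n N G /\ P z G) ->
  exists Z G, [/\ sorted ltn Z, size Z = r,
    all (fun a => a < r * (N ^ n) ^ #|I|) Z, sides_in n N G &
    {in Z, forall z, P z G}].
Proof.
move=> /choice[G GP].
have /choice[c cG] z := sides_in_code (proj1 (GP z)).
set M := r * _.
have [||t [Z [subZ szZ cZ]]] := @pigeonhole_subseq _ _ c (iota 0 M) r.
- by apply/card_gt0P; exists (c 0).
- by rewrite size_iota card_ffun card_tuple card_ord.
have Gt z : z \in Z -> G z = (fun i => map val (t i)).
  by move=> /cZ <-; apply: funext => i; exact: cG.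
have ZM a : a \in Z -> a < M.
  by move=> /(mem_subseq subZ); rewrite mem_iota => /andP[].
case: Z => [|z0 Z] in subZ szZ cZ Gt ZM *.
- by exists [::], (G 0); split; rewrite -?szZ //; exact: (proj1 (GP 0)).
exists (z0 :: Z), (G z0); split=> //.
- by apply: subseq_sorted subZ (iota_ltn_sorted _ _); exact: ltn_trans.
- by apply/allP.
- exact: (proj1 (GP z0)).
- by move=> z zZ; rewrite (Gt _ (mem_head _ _)) -(Gt _ zZ); exact: (proj2 (GP z)).
Qed.

Lemma upd_same y i z : upd y i z i = z.
Proof. by rewrite /upd eqxx. Qed.

Lemma upd_other y i z j : j != i -> upd y i z j = y j.
Proof. by rewrite /upd => /negbTE ->. Qed.

Lemma grid_fiber S G Z y i x : i \in S ->
  grid S (fun j => if j == i then Z else G j) y x ->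
  x i \in Z /\ grid (S :\ i) G (upd y i (x i)) x.
Proof.
move=> iS gx; split; first by have := gx i; rewrite iS eqxx.
move=> j; have := gx j; rewrite !inE /upd; case: eqVneq => [->|//] _ /=.
by [].
Qed.

Lemma sides_in_cons n N N' G i Z : N <= N' -> sides_in n N G ->
  sorted ltn Z -> size Z = n -> {in Z, forall a, a < N'} ->
  sides_in n N' (fun j => if j == i then Z else G j).
Proof.
move=> NN' GP sZ zZ ZN j; case: eqP => _; last exact: (sides_inW NN' GP).
by split=> //; apply/allP.
Qed.

(** The edges from [x] in direction [i] towards larger values all have the same
colour, which may depend on [x] and [i]. *)
Definition end_hom S y (c : (I -> nat) -> (I -> nat) -> bool) G : Prop :=
  forall i x x1 x2, i \in S -> grid S G y x -> grid S G y x1 -> grid S G y x2 ->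
    (forall j, j != i -> x1 j = x j) -> (forall j, j != i -> x2 j = x j) ->
    x i < x1 i -> x i < x2 i -> c x x1 = c x x2.

(** The first factor is the number of values that [end_homogeneous] needs in the
new coordinate, the second one the number of subgrids to choose from. *)
Fixpoint end_hom_size (d K l : nat) : nat :=
  if l is l'.+1
  then (2 ^ (K ^ d)) ^ K * (end_hom_size d K l' ^ K) ^ d else K.

Lemma end_hom_size_ge d K l : 0 < K -> K <= end_hom_size d.+1 K l.
Proof.
move=> K0; elim: l => //= l IHl; apply: leq_trans IHl _.
set N := end_hom_size _ _ _.
apply: (@leq_trans (N ^ K)).
  by case: (N) => // N'; rewrite -[leqLHS]expn1 leq_pexp2l.
apply: leq_trans (leq_pmull _ _); last by rewrite !expn_gt0.
by case: (_ ^ _) => // N'; rewrite -[leqLHS]expn1 leq_pexp2l.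
Qed.

(** By induction, for each value [z] of a new coordinate [i] the other
coordinates have an end-homogeneous subgrid, and [uniform_grid] makes it the same
one for many [z]. It has at most [K ^ d] points, so that a pair [z < z'] has one of
[2 ^ (K ^ d)] colourings of the edges from level [z] to level [z'], and
[end_homogeneous] thins out the values [z]. *)
Lemma end_hom_grid (K : nat) (c : (I -> nat) -> (I -> nat) -> bool) : 0 < K ->
  forall l S y, #|S| = l ->
  exists G, sides_in K (end_hom_size #|I| K l) G /\ end_hom S y c G.
Proof.
move=> K0; elim=> [|l IHl] S y cardS.
  exists (fun=> iota 0 K); split; first exact: sides_in_iota.
  by move=> i x x1 x2; move/eqP: cardS; rewrite cards_eq0 => /eqP ->; rewrite inE.
have /card_gt0P[i iS] : 0 < #|S| by rewrite cardS.
have cardS' : #|S :\ i| = l by move: (cardsD1 i S); rewrite iS cardS => -[].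
pose r := (2 ^ (K ^ #|I|)) ^ K.
have [Z [G [sZ szZ ZM GP hom_G]]] :=
  @uniform_grid K _ (fun z G => end_hom (S :\ i) (upd y i z) c G) r
    (fun z => IHl _ (upd y i z) cardS').
pose pt (p : {ffun I -> 'I_K}) z j :=
  if j == i then z else if j \in S then nth 0 (G j) (p j) else y j.
pose chi z z' : {ffun {ffun I -> 'I_K} -> bool} :=
  [ffun p => c (pt p z) (pt p z')].
have I0 : 0 < #|I| by apply/card_gt0P; exists i.
have [|||Z' [subZ szZ' hom_Z']] := @end_homogeneous _ (2 ^ (K ^ #|I|)) chi _ _ K Z sZ.
- by rewrite -[1]/(2 ^ 0) ltn_exp2l // expn_gt0 K0.
- by rewrite !card_ffun card_bool card_ord.
- by rewrite szZ.
exists (fun j => if j == i then Z' else G j); split.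
  apply: sides_in_cons GP _ szZ' _.
  - rewrite /=; case: #|I| I0 => // d _.
    have := end_hom_size_ge d l K0; set N := end_hom_size _ _ _ => KN.
    apply: (@leq_trans ((N ^ K) ^ d.+1)); last by rewrite leq_pmull // !expn_gt0.
    have N0 : 0 < N by exact: leq_trans KN.
    by rewrite -expnM -[leqLHS]expn1 leq_pexp2l // muln_gt0 K0.
  - by apply: subseq_sorted subZ sZ; exact: ltn_trans.
  - by move=> a /(mem_subseq subZ); exact: (allP ZM).
move=> i0 x x1 x2 i0S gx gx1 gx2 ex1 ex2 lt1 lt2.
have [xZ fx] := grid_fiber iS gx.
have [x1Z fx1] := grid_fiber iS gx1.
have [x2Z fx2] := grid_fiber iS gx2.
case: (eqVneq i0 i) => [i0i|ni0i].
- subst i0.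
  pose p : {ffun I -> 'I_K} :=
    [ffun j => insubd (Ordinal K0) (index (x j) (G j))].
  have ptE x' : grid S (fun j => if j == i then Z' else G j) y x' ->
      (forall j, j != i -> x' j = x j) -> x' = pt p (x' i).
    move=> gx' ex'; apply: funext => j; rewrite /pt.
    case: eqVneq => [->//|ji]; rewrite ex' //.
    have := gx j; rewrite (negbTE ji); case: ifP => // _ xjG.
    have [_ szG _] := GP j.
    have ltK : index (x j) (G j) < K by rewrite -szG index_mem.
    by rewrite ffunE val_insubd ltK nth_index.
  have /ffunP/(_ p) := hom_Z' _ _ _ xZ x1Z x2Z lt1 lt2.
  by rewrite !ffunE -!ptE.
- have x1i : x1 i = x i by rewrite ex1 // eq_sym.
  have x2i : x2 i = x i by rewrite ex2 // eq_sym.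
  rewrite x1i in fx1; rewrite x2i in fx2.
  by apply: (hom_G _ (mem_subseq subZ xZ) i0) => //; rewrite !inE ni0i.
Qed.

(** In the new coordinate, [m * q] values with the same subgrid leave [m] values
with the same subgrid and the same of the [q] colours. *)
Fixpoint mono_size (d q m l : nat) : nat :=
  if l is l'.+1 then (m * q) * (mono_size d q m l' ^ m) ^ d else m.

Lemma mono_size_gt0 d q m l : 0 < q -> 0 < m -> 0 < mono_size d q m l.
Proof.
by move=> q0 m0; elim: l => //= l IHl; rewrite !muln_gt0 m0 q0 !expn_gt0 IHl.
Qed.

Lemma monochromatic_grid (C : finType) (m : nat) (col : (I -> nat) -> C) :
  0 < m -> forall l S y, #|S| = l ->
  exists G, sides_in m (mono_size #|I| #|C| m l) G /\
    exists t, forall x, grid S G y x -> col x = t.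
Proof.
move=> m0; have C0 : 0 < #|C| by apply/card_gt0P; exists (col (fun=> 0)).
elim=> [|l IHl] S y cardS.
  exists (fun=> iota 0 m); split; first exact: sides_in_iota.
  exists (col y) => x gx; congr col; apply: funext => i; have := gx i.
  by move/eqP: cardS; rewrite cards_eq0 => /eqP ->; rewrite inE.
have /card_gt0P[i iS] : 0 < #|S| by rewrite cardS.
have I0 : 0 < #|I| by apply/card_gt0P; exists i.
have cardS' : #|S :\ i| = l by move: (cardsD1 i S); rewrite iS cardS => -[].
have [Z [G [sZ szZ ZM GP hom_G]]] :=
  @uniform_grid m _ (fun z G => exists t, forall x,
      grid (S :\ i) G (upd y i z) x -> col x = t) (m * #|C|)
    (fun z => IHl _ (upd y i z) cardS').
have /choice[h hP] z : exists t, z \in Z -> forall x,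
    grid (S :\ i) G (upd y i z) x -> col x = t.
  case: (boolP (z \in Z)) => [/hom_G[t tP]|_]; first by exists t.
  by exists (col y).
have [||t [Z' [subZ szZ' hom_Z']]] := @pigeonhole_subseq _ _ h Z m => //.
  by rewrite szZ.
exists (fun j => if j == i then Z' else G j); split.
  apply: sides_in_cons GP _ szZ' _.
  - rewrite /=; set N := mono_size _ _ _ _.
    have N0 : 0 < N by exact: mono_size_gt0.
    apply: leq_trans (leq_pmull _ _); last by rewrite muln_gt0 m0.
    by rewrite -expnM -[leqLHS]expn1 leq_pexp2l // muln_gt0 m0.
  - by apply: subseq_sorted subZ sZ; exact: ltn_trans.
  - by move=> a /(mem_subseq subZ); exact: (allP ZM).
exists t => x gx; have [xZ fx] := grid_fiber iS gx.
by rewrite (hP _ (mem_subseq subZ xZ) _ fx) hom_Z'.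
Qed.

(** In an end-homogeneous subgrid, the colour of an edge from [x] in direction
[i] is that of the edge from [x] to the last value of coordinate [i]. This
defines [2 ^ d] colours for the points of the subgrid, and on a monochromatic
part of it each direction has one colour. *)
Lemma homogeneous_directions (m : nat) (c : (I -> nat) -> (I -> nat) -> bool) :
  0 < m ->
  exists G (sigma : I -> bool),
    sides_in m (end_hom_size #|I|
      (mono_size #|I| (2 ^ #|I|) m #|I|) #|I|) G /\
    forall i x x', (forall j, x j \in G j) -> x' i \in G i ->
      (forall j, j != i -> x' j = x j) -> x i < x' i -> c x x' = sigma i.
Proof.
move=> m0; set K := mono_size _ _ _ _; set N := end_hom_size _ _ _.
have K0 : 0 < K by apply: mono_size_gt0; rewrite ?expn_gt0.
have [G [GP hom_G]] := @end_hom_grid K c K0 #|I| [set: I]%SET (fun=> 0) (cardsT I).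
pose pt (k : I -> nat) i := nth 0 (G i) (k i).
(* When [k i] is itself the last index, no edge leaves the point in direction [i]
   and the colour is arbitrary. *)
pose col k : {ffun I -> bool} := [ffun i => c (pt k) (upd (pt k) i (nth 0 (G i) K.-1))].
have [H [HP [t colH]]] :=
  @monochromatic_grid _ m col m0 #|I| [set: I]%SET (fun=> 0) (cardsT I).
rewrite card_ffun card_bool -/K in HP.
have szG i : size (G i) = K by have [] := GP i.
have sG i : sorted ltn (G i) by have [] := GP i.
have HK i k : k \in H i -> k < K by have [_ _ /allP/(_ k)] := HP i.
have ltG i k k' : k < K -> k' < K -> (nth 0 (G i) k < nth 0 (G i) k') = (k < k').
  have homG a b : a < K -> b < K -> a < b -> nth 0 (G i) a < nth 0 (G i) b.
    by move=> aK bK; apply: (sorted_ltn_nth ltn_trans) => //; rewrite inE szG.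
  move=> kK k'K; case: (ltngtP k k') => [lt|gt|->]; last by rewrite ltnn.
    by rewrite homG.
  by rewrite ltnNge ltnW // homG.
exists (fun i => map (nth 0 (G i)) (H i)), t; split.
  move=> i; have [sH szH _] := HP i; split.
  - apply: (homo_sorted_in (P := [pred k | k < K])) sH.
      by move=> a b /=; rewrite !inE => aK bK ab; rewrite ltG.
    by apply/allP => a /HK.
  - by rewrite size_map.
  - apply/allP => _ /mapP[k /HK kK ->]; have [_ _ /allP] := GP i; apply.
    by rewrite mem_nth // szG.
move=> i x x' xH x'H ex lt.
have /choice[k kP] : forall j, exists k, k \in H j /\ x j = nth 0 (G j) k.
  by move=> j; have /mapP[k kH ->] := xH j; exists k.
have xE : x = pt k by apply: funext => j; rewrite (proj2 (kP j)).
have kt : grid [set: I]%SET H (fun=> 0) k by move=> j; rewrite inE; exact: (proj1 (kP j)).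
have := colH _ kt => /ffunP/(_ i) <-; rewrite ffunE -xE.
have /mapP[k' /HK k'K x'E] := x'H.
have gridG z : (forall j, z j \in G j) -> grid [set: I]%SET G (fun=> 0) z.
  by move=> zG j; rewrite inE.
have pG j l : l < K -> nth 0 (G j) l \in G j by move=> lK; rewrite mem_nth ?szG.
have xG j : x j \in G j by rewrite (proj2 (kP j)) pG // (HK j) // (proj1 (kP j)).
have lt' : k i < k'.
  rewrite -(ltG i) // -?x'E -?(proj2 (kP i)) //.
  exact: HK (proj1 (kP i)).
apply: (hom_G i) => //; rewrite ?inE //.
- exact: gridG.
- by apply: gridG => j; case: (eqVneq j i) => [->|/ex->] //; rewrite x'E pG.
- apply: gridG => j; case: (eqVneq j i) => [->|ji].
    by rewrite upd_same pG // prednK.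
  by rewrite upd_other.
- by move=> j ji; rewrite upd_other.
- rewrite upd_same (proj2 (kP i)) ltG //; last by rewrite prednK.
    by rewrite -ltnS prednK //; exact: leq_ltn_trans lt' k'K.
  exact: HK (proj1 (kP i)).
Qed.
End Grids.

(** * Dominating coordinates *)

Section Lexicographic.
Variables (I : finType) (disp : Order.disp_t) (R : orderType disp).
Implicit Types (x y : I -> nat) (S : {set I}) (L : seq I) (f : (I -> nat) -> R).

Fixpoint lex L x y : bool :=
  if L is i :: L' then (x i < y i) || (x i == y i) && lex L' x y else false.

Lemma eq_lex L x x' z z' :
  {in L, forall j, (x j < x' j) = (z j < z' j) /\ (x j == x' j) = (z j == z' j)} ->
  lex L x x' = lex L z z'.
Proof.
elim: L => //= i L IHL eqL; have [-> ->] := eqL i (mem_head _ _).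
by rewrite IHL // => j jL; apply: eqL; rewrite inE jL orbT.
Qed.

Lemma lex_total L x y : [\/ lex L x y, lex L y x | {in L, x =1 y}].
Proof.
elim: L => [|i L IHL] /=; first by constructor 3.
case: (ltngtP (x i) (y i)) => [_|_|xy]; [by constructor 1|by constructor 2|].
case: IHL => [->|->|eqL]; [by constructor 1|by constructor 2|constructor 3].
by move=> j; rewrite inE => /orP[/eqP->|/eqL].
Qed.

Lemma lexP i0 L x y : lex L x y <->
  exists2 r, r < size L & x (nth i0 L r) < y (nth i0 L r) /\
    forall r', r' < r -> x (nth i0 L r') = y (nth i0 L r').
Proof.
elim: L => [|i L IHL] /=; first by split=> // -[].
split.
  (* If [x i < x' i], then [x] lies below the point that starts cell [v'] in
   direction [i] and the pieces next to its own in the other directions; the value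
   there is smaller than at the point that starts the last piece of cell [v'] and
   the pieces of [x'] in the other directions, and this point lies below [x']. *)
case/orP => [lt|/andP[/eqP xy /IHL[r rL [lt eqr]]]]; first by exists 0.
  by exists r.+1 => //; split=> // -[|r'] //= /eqr.
case=> -[|r] rL [/= lt eqr]; first by rewrite lt.
apply/orP; right; apply/andP; split; first by apply/eqP; exact: (eqr 0).
by apply/IHL; exists r => //; split=> // r' r'r; exact: (eqr r'.+1).
Qed.

Definition increasing_on S N y f : Prop :=
  forall x x', (forall j, j \in S -> x j <= x' j < N) ->
    (forall j, j \notin S -> x j = y j /\ x' j = y j) ->
    (exists2 j, j \in S & x j < x' j) -> (f x < f x')%O.

Lemma increasing_on_le S N y f x x' : increasing_on S N y f ->
  (forall j, j \in S -> x j <= x' j < N) ->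
  (forall j, j \notin S -> x j = y j /\ x' j = y j) -> (f x <= f x')%O.
Proof.
move=> incf xx' xy.
case: (pselect (exists2 j, j \in S & x j < x' j)) => [ex|nex].
  by apply: ltW; apply: incf.
suff -> : x = x' by [].
apply: funext => j; case: (boolP (j \in S)) => [jS|/xy[-> ->]//].
apply/eqP; rewrite eqn_leq; have /andP[-> _] := xx' j jS; rewrite leqNgt.
by apply/negP => lt; apply: nex; exists j.
Qed.

Lemma increasing_on_steps N y f :
  (forall i x x', (forall j, x j < N) -> (forall j, x' j < N) ->
     (forall j, j != i -> x' j = x j) -> x i < x' i -> (f x < f x')%O) ->
  increasing_on [set: I]%SET N y f.
Proof.
move=> step x x' xx' _ [i _ lt].
have [n] := ubnP #|[pred j | x j != x' j]|.
elim: n x xx' i lt => // n IHn x xx' i lt.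
have xN j : x j < N by have /andP[le lt'] := xx' j (finset.in_setT _); exact: leq_ltn_trans lt'.
have x'N j : x' j < N by have /andP[] := xx' j (finset.in_setT _).
rewrite (cardD1 i) inE neq_ltn lt /= add1n ltnS => card_n.
pose z := upd x i (x' i).
have zE j : z j = if j == i then x' j else x j by rewrite /z /upd; case: eqP => [->|].
have xz : (f x < f z)%O.
  apply: (step i) => //; rewrite ?zE ?eqxx //; last by move=> j /negbTE ji; rewrite zE ji.
  by move=> j; rewrite zE; case: ifP.
case: (pselect (exists j, z j < x' j)) => [[j zj]|nz].
  apply: lt_trans xz _; apply: (IHn z) zj _.
    by move=> j' _; rewrite zE; case: ifP => _; rewrite ?leqnn //=; exact: xx'.
  apply: leq_ltn_trans card_n; apply: subset_leq_card; apply/fintype.subsetP => j'.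
  by rewrite !inE zE; case: (eqVneq j' i) => [->|_]; rewrite ?eqxx.
suff -> : x' = z by [].
apply: funext => j; apply/eqP; rewrite eq_sym eqn_leq zE; case: ifP => ji.
  by rewrite !leqnn.
have /andP[-> _] := xx' j (finset.in_setT _); rewrite leqNgt; apply/negP => ltj.
by apply: nz; exists j; rewrite zE ji.
Qed.

(** Otherwise, for every coordinate [i] of [S], resetting [i] to [0] while
raising all other coordinates by one never decreases [F]. Doing this once for
each coordinate of [S] leads from the constant [#|S|] to a point all of whose
coordinates are smaller, which contradicts monotonicity. *)
Lemma dominating_coordinate S (F : (I -> nat) -> R) (s := (2 * #|I|).+1) :
  0 < #|S| ->
  (forall x x', (forall j, j \in S -> x j <= x' j < s) ->
     (exists2 j, j \in S & x j < x' j) -> (F x < F x')%O) ->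
  exists i (a : {ffun I -> 'I_s}), [/\ i \in S, forall j, (a j).+1 < s &
    (F (upd (fun j => (a j).+1) i 0) < F (upd (fun j => nat_of_ord (a j)) i s.-1))%O].
Proof.
move=> /card_gt0P[i0 i0S] incF; apply: contrapT => no_dom.
pose k := size (enum S).
have kI : k <= #|I| by rewrite /k -cardE max_card.
have lt_kt t : t < k -> k + t < 2 * #|I| by move: k (#|I|) kI => a b; lia.
(* The point after [t] steps: the coordinate of rank [r] in [S] starts at [k], is
   reset to [0] by step number [r.+1], and grows by one in every other step. *)
pose pt t j := let r := index j (enum S) in if t <= r then k + t else t.-1 - r.
have pt_lt t j : t < k -> (pt t j).+1 < s.
  by rewrite /pt /s => /[dup] tk /lt_kt; case: ifP => _; lia.
have chain t : t <= k -> (F (pt 0) <= F (pt t))%O.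
  elim: t => // t IHt tk; apply: le_trans (IHt (ltnW tk)) _.
  pose i := nth i0 (enum S) t.
  have iS : i \in S by rewrite -mem_enum mem_nth.
  have ri : index i (enum S) = t by rewrite index_uniq // enum_uniq.
  have pti : pt t i = k + t by rewrite /pt ri leqnn.
  apply: (@le_trans _ _ (F (upd (pt t) i s.-1))).
    apply/ltW/incF; last first.
      by exists i; rewrite // upd_same pti /s /= lt_kt.
    move=> j _; case: (eqVneq j i) => [->|ji].
      by rewrite upd_same pti /s /= ltnSn andbT ltnW // lt_kt.
    by rewrite upd_other // leqnn /= ltnW // pt_lt.
  rewrite leNgt; apply/negP => lt; apply: no_dom.
  pose a : {ffun I -> 'I_s} := [ffun j => inord (pt t j)].
  have aE j : a j = pt t j :> nat.
    by rewrite ffunE inordK // ltnW // pt_lt.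
  exists i, a; split=> //; first by move=> j; rewrite aE pt_lt.
  have -> : (fun j => nat_of_ord (a j)) = pt t by apply: funext.
  have <- // : pt t.+1 = upd (fun j => (a j).+1) i 0.
  apply: funext => j; rewrite /upd; case: eqVneq => [->|ji].
    by rewrite /pt ri ltnn subnn.
  have rj : index j (enum S) != t.
    apply: contra ji => /eqP rj; rewrite /i -rj nth_index //.
    by rewrite -index_mem rj.
  rewrite aE /pt; case: ltngtP rj => // lt' _; first by rewrite addnS.
  by rewrite /=; lia.
have := chain k (leqnn _); rewrite leNgt => /negP; apply; apply: incF.
  move=> j jS; rewrite /pt /=.
  have rj : index j (enum S) < k by rewrite index_mem mem_enum.
  by rewrite [k <= index _ _]leqNgt rj /= /s; move: (#|I|) kI => d; lia.
exists i0 => //; rewrite /pt /=.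
have rj : index i0 (enum S) < k by rewrite index_mem mem_enum.
by rewrite [k <= index _ _]leqNgt rj /=; lia.
Qed.

Definition ffupd (B : nat) (kappa : {ffun I -> 'I_B}) i v : {ffun I -> 'I_B} :=
  [ffun j => if j == i then v else kappa j].

(** Averaging: a cell of colour [(i, a)] is counted on its line in direction [i].
There are [#|I| * #|A|] colours and as many lines in a direction as there are
cells, divided by [B]; so some line and some colour with the direction of that
line meet in at least [B / (#|I| * #|A|) = M] cells. *)
Lemma dense_line (A : finType) (B M : nat) (col : {ffun I -> 'I_B} -> I * A) :
  0 < M -> B = #|I| * #|A| * M ->
  0 < B -> exists kappa i a, M <= #|[pred v | col (ffupd kappa i v) == (i, a)]|.
Proof.
move=> M0 BE B0; apply: contrapT => no_line.
pose W := #|{: {ffun I -> 'I_B}}|.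
have W0 : 0 < W by rewrite /W card_ffun card_ord expn_gt0 B0.
pose h (p : I * A) kappa := (col kappa == p : nat).
have sumE (p : I * A) : \sum_(kv : {ffun I -> 'I_B} * 'I_B) h p (ffupd kv.1 p.1 kv.2)
    = \sum_(kv : {ffun I -> 'I_B} * 'I_B) h p kv.1.
  (* Exchanging the value of [kappa] at [p.1] with [v] is an involution on pairs. *)
  pose sw (kv : {ffun I -> 'I_B} * 'I_B) := (ffupd kv.1 p.1 kv.2, kv.1 p.1).
  have swK : involutive sw.
    move=> [kappa v]; rewrite /sw /=; congr pair; last by rewrite ffunE eqxx.
    by apply/ffunP => j; rewrite !ffunE; case: eqP => [->|].
  by rewrite [RHS](reindex_inj (inv_inj swK)).
have : W * B <= #|I| * #|A| * (W * M.-1).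
  have -> : W * B = \sum_(p : I * A) \sum_(kv : {ffun I -> 'I_B} * 'I_B) h p kv.1.
    rewrite exchange_big /= -[B in LHS]card_ord /W -card_prod -sum1_card.
    apply: eq_bigr => kv _; rewrite (bigD1 (col kv.1)) //= /h eqxx big1 // => p.
    by rewrite eq_sym => /negbTE ->.
  rewrite -card_prod -sum_nat_const; apply: leq_sum => p _; rewrite -sumE.
  rewrite -(pair_bigA _ (fun kappa v => h p (ffupd kappa p.1 v))) /=.
  rewrite /W -sum_nat_const; apply: leq_sum => kappa _.
  rewrite -ltnS prednK //; apply: contraPT no_line; rewrite -leqNgt => le.
  apply; exists kappa, p.1, p.2; apply: leq_trans le _.
  rewrite -sum1_card [leqRHS]big_mkcond /=; apply: leq_sum => v _.
  by rewrite inE /h -surjective_pairing; case: ifP.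
apply/negP; rewrite -ltnNge BE [ltnLHS]mulnCA ltn_pmul2l // ltn_pmul2l; first by lia.
by move: B0; rewrite BE !muln_gt0 => /andP[/andP[-> ->]].
Qed.
(** * Lex-monotone subgrids of increasing arrays *)

(** The family must not depend on [f]: then the number of its members is what the
pigeonhole argument in [extend_lex_family] has to pay. *)
Definition lex_family (n N k : nat) (T : finType)
    (fam : {set I} -> T -> (I -> seq nat) * seq I) : Prop :=
  forall S y f, #|S| = k -> increasing_on S N y f ->
  exists t, let: (G, L) := fam S t in
    [/\ sides_in n N G, uniq L, L =i S &
     forall x x', grid S G y x -> grid S G y x' -> lex L x x' -> (f x < f x')%O].

Lemma lex_family1 n :
  lex_family n n 1 (fun S (_ : unit) => (fun=> iota 0 n, enum S)).
Proof.
move=> S y f /eqP/cards1P[i ->] incf; exists tt; split.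
- exact: sides_in_iota.
- exact: enum_uniq.
- by move=> j; rewrite mem_enum.
move=> x x' gx gx'; rewrite enum_set1 /= andbF orbF => lt; apply: incf.
- move=> j; rewrite inE => /eqP ->; rewrite ltnW //=.
  by have := gx' i; rewrite inE eqxx mem_iota => /andP[].
- move=> j; rewrite inE => /negbTE ji; have := gx j; have := gx' j.
  by rewrite !inE ji => -> ->.
- by exists i; rewrite ?inE.
Qed.

(** A member of the new family consists of the dominating direction [i], of the
cell and the piece of it that are used in each other direction, of the [n] cells
used in direction [i], and of a member of the old family. *)
Definition extension_index (n s B : nat) (T : finType) : finType :=
  (I * {ffun I -> 'I_s} * {ffun I -> 'I_B} *
    {V : n.-tuple 'I_B | sorted ltn (map val V)} * T)%type.

(** In direction [i] the values are the starting points of the last pieces of the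
cells in [V]; in another direction [j], the old subgrid is moved into piece
number [a j] of cell number [kappa j]. *)
Definition extend_family (n s B N : nat) (T : finType)
    (fam : {set I} -> T -> (I -> seq nat) * seq I)
    (S : {set I}) (t : extension_index n s B T) : (I -> seq nat) * seq I :=
  let: (i, a, kappa, V, t0) := t in
  let: (G, L) := fam (S :\ i) t0 in
  (fun j => if j == i then [seq (v * s + s.-1) * N | v <- map val (val V)]
            else [seq (kappa j * s + a j) * N + g | g <- G j],
   i :: L).

Lemma digits_lt B s N k p r : k < B -> p < s -> r < N ->
  (k * s + p) * N + r < B * s * N.
Proof.
move=> kB ps rN.
have h1 : k.+1 * s <= B * s by rewrite leq_mul2r kB orbT.
have h2 : (k * s + p).+1 * N <= B * s * N.
  by rewrite leq_mul2r (leq_trans _ h1) ?orbT // mulSn; lia.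
by rewrite mulSn in h2; apply: leq_trans h2; rewrite addnC ltn_add2r.
Qed.

(** The side is cut into [B] cells, each cell into [s] pieces of length [N].
A dominating coordinate of every cell, together with [dense_line], yields one
direction [i] that dominates on [n * #|T|] cells of a line: there, moving up in
[i] outweighs any move inside one fixed piece of each other side. For each of
these cells the old family offers one of [#|T|] subgrids of those pieces, so [n]
cells agree on it. *)
Lemma extend_lex_family (n N k : nat) (T : finType)
    (fam : {set I} -> T -> (I -> seq nat) * seq I)
    (s := (2 * #|I|).+1) (B := #|I| * s ^ #|I| * (n * #|T|)) :
  0 < n -> 0 < N -> 0 < #|T| -> lex_family n N k fam ->
  lex_family n (B * s * N) k.+1 (@extend_family n s B N T fam).
Proof.
move=> n0 N0 T0 famP S y f cardS incf.
have S0 : 0 < #|S| by rewrite cardS.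
have I0 : 0 < #|I| by apply: leq_trans S0 _; rewrite max_card.
have B0 : 0 < B by rewrite /B !muln_gt0 expn_gt0 I0 n0.
(* the point of the box that starts piece [p] of cell [c] in the directions of [S] *)
pose put (c p : I -> nat) j := if j \in S then (c j * s + p j) * N else y j.
have put_lt c p : c < B -> p < s -> (c * s + p) * N < B * s * N.
  by move=> cB ps; have := digits_lt cB ps N0; rewrite addn0.
have colP (kappa : {ffun I -> 'I_B}) : exists ia : I * {ffun I -> 'I_s},
    [/\ ia.1 \in S, forall j, (ia.2 j).+1 < s &
      (f (put (fun j => kappa j) (upd (fun j => (ia.2 j).+1) ia.1 0)) <
       f (put (fun j => kappa j) (upd (fun j => nat_of_ord (ia.2 j)) ia.1 s.-1)))%O].
  have [|i [a [iS aP lt]]] :=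
    @dominating_coordinate S (fun p => f (put (fun j => kappa j) p)) S0.
    move=> x x' xx' [i iS lt]; apply: incf.
    - move=> j jS; have /andP[le lts] := xx' j jS; rewrite /put jS put_lt //.
      by rewrite leq_mul2r leq_add2l le orbT.
    - by move=> j /negbTE jS; rewrite /put jS.
    - by exists i; rewrite // /put iS ltn_pmul2r // ltn_add2l.
  by exists (i, a).
have /choice[col colE] := colP.
have [||kappa [i [a line]]] := @dense_line {ffun I -> 'I_s} B (n * #|T|) col _ _ B0.
- by rewrite muln_gt0 n0.
- by rewrite card_ffun card_ord.
have hit v : col (ffupd kappa i v) = (i, a) ->
    [/\ i \in S, forall j, (a j).+1 < s &
      (f (put (upd (fun j => nat_of_ord (kappa j)) i v) (upd (fun j => (a j).+1) i 0)) <
       f (put (upd (fun j => nat_of_ord (kappa j)) i v)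
            (upd (fun j => nat_of_ord (a j)) i s.-1)))%O].
  move=> cv; have := colE (ffupd kappa i v); rewrite cv /=.
  suff -> : (fun j => nat_of_ord (ffupd kappa i v j)) =
            upd (fun j => nat_of_ord (kappa j)) i v by [].
  by apply: funext => j; rewrite /upd ffunE; case: eqP.
have [iS aP] : i \in S /\ forall j, (a j).+1 < s.
  have /card_gt0P[v] : 0 < #|[pred v | col (ffupd kappa i v) == (i, a)]|.
    by apply: leq_trans line; rewrite muln_gt0 n0.
  by rewrite inE => /eqP/hit[].
have cardS' : #|S :\ i| = k by move: (cardsD1 i S); rewrite iS cardS => -[].
pose top v := (v * s + s.-1) * N.
pose off j := (kappa j * s + a j) * N.
pose shift (x : I -> nat) j := if j \in S :\ i then off j + x j else x j.
have top_lt v : v < B -> top v < B * s * N.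
  by move=> vB; have := digits_lt vB (ltnSn s.-1) N0; rewrite addn0.
have off_lt j r : r < N -> off j + r < B * s * N by move=> rN; exact: digits_lt.
have /choice[h hP] (v : 'I_B) : exists t, let: (G, L) := fam (S :\ i) t in
    [/\ sides_in n N G, uniq L, L =i S :\ i &
     forall x x', grid (S :\ i) G (upd y i (top v)) x ->
       grid (S :\ i) G (upd y i (top v)) x' -> lex L x x' ->
       (f (shift x) < f (shift x'))%O].
  apply: (famP _ _ (f \o shift)) => // x x' xx' exx' [j jS' lt] /=.
  apply: incf.
  - move=> j' j'S; rewrite /shift; case: ifP => j'S'.
      by have /andP[le lt'] := xx' _ j'S'; rewrite leq_add2l le off_lt.
    have [-> ->] := exx' j' (negbT j'S').
    have -> : j' = i by apply/eqP; move: j'S'; rewrite !inE j'S andbT => /negbFE.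
    by rewrite upd_same leqnn top_lt.
  - move=> j' j'S; have j'S' : j' \notin S :\ i by rewrite !inE (negbTE j'S) andbF.
    rewrite /shift (negbTE j'S').
    have j'i : j' != i by apply: contraNneq j'S => ->.
    by have := exx' j' j'S'; rewrite upd_other.
  - exists j; first by move: jS'; rewrite !inE => /andP[].
    by rewrite /shift jS' ltn_add2l.
have [||t [V [subV szV hV]]] := @pigeonhole_subseq _ _ h
    (enum [pred v | col (ffupd kappa i v) == (i, a)]) n => //.
  by rewrite -cardE.
have Vcol v : v \in V -> col (ffupd kappa i v) = (i, a).
  by move=> /(mem_subseq subV); rewrite mem_enum inE => /eqP.
have sV : sorted ltn (map val V).
  apply: subseq_sorted (iota_ltn_sorted 0 B); first exact: ltn_trans.
  rewrite -val_enum_ord; apply: map_subseq; apply: subseq_trans subV _.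
  by rewrite {1}/enum_mem -enumT; exact: filter_subseq.
exists (i, a, kappa, exist _ (Tuple (introT eqP szV)) sV, t) => /=.
case Gt : (fam (S :\ i) t) => [G L].
have [v0 v0V] : exists v, v \in V.
  by case: (V) szV n0 => [<-//|v ? _ _]; exists v; rewrite mem_head.
have hV' v : v \in V -> [/\ sides_in n N G, uniq L, L =i S :\ i &
     forall x x', grid (S :\ i) G (upd y i (top v)) x ->
       grid (S :\ i) G (upd y i (top v)) x' -> lex L x x' ->
       (f (shift x) < f (shift x'))%O].
  by move=> /hV hv; have := hP v; rewrite hv Gt.
have [GP uL LS _] := hV' _ v0V.
split.
- move=> j; have [sG zG /allP GN] := GP j; case: eqP => _; split.
  + rewrite sorted_map; apply: sub_sorted sV => u v uv /=.
    by rewrite ltn_pmul2r // ltn_add2r ltn_pmul2r.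
  + by rewrite !size_map szV.
  + by apply/allP => _ /mapP[_ /mapP[v _ ->] ->]; exact: top_lt.
  + rewrite sorted_map; apply: sub_sorted sG => u v uv /=.
    by rewrite ltn_add2l.
  + by rewrite size_map.
  + by apply/allP => _ /mapP[g /GN gN ->]; exact: off_lt.
- by rewrite /= LS !inE eqxx uL.
- by move=> j; rewrite inE LS !inE; case: eqVneq => [->|].
set G' := fun j => _.
pose unshift (x : I -> nat) j := if j \in S :\ i then x j - off j else x j.
have gridE x : grid S G' y x -> exists v, [/\ v \in V, x i = top v,
    shift (unshift x) = x, (forall j, j \in S :\ i -> off j <= x j < off j + N) &
    grid (S :\ i) G (upd y i (top v)) (unshift x)].
  move=> gx; have := gx i; rewrite iS /G' eqxx => /mapP[_ /mapP[v vV ->] xi].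
  have xj j : j \in S :\ i -> exists2 g, g \in G j & x j = off j + g.
    rewrite !inE => /andP[ji jS]; have := gx j; rewrite jS /G' (negbTE ji).
    by move=> /mapP[g gG xg]; exists g.
  exists v; split=> //.
  - apply: funext => j; rewrite /shift /unshift /=.
    case jS': (j \in S :\ i) => //.
    by have [g _ ->] := xj j jS'; rewrite addKn.
  - move=> j /xj[g gG ->]; rewrite leq_addr ltn_add2l.
    by have [_ _ /allP] := GP j; apply.
  - move=> j; rewrite /unshift; case jS': (j \in S :\ i).
      by have [g gG ->] := xj j jS'; rewrite addKn.
    move: jS' => /negbT; rewrite !inE negb_and negbK => /orP[/eqP->|jS]; first by rewrite upd_same.
    have ji : j != i by apply: contraNneq jS => ->.
    by have := gx j; rewrite (negbTE jS) upd_other.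
move=> x x' gx gx' /=.
have [v [vV xi xE xlt xG]] := gridE x gx.
have [v' [vV' xi' xE' xlt' xG']] := gridE x' gx'.
have off_grid j : j \notin S -> x j = y j /\ x' j = y j.
  by move=> /negbTE jS; have := gx j; have := gx' j; rewrite jS => -> ->.
have S'S j : j \in S -> j != i -> j \in S :\ i by move=> jS ji; rewrite !inE ji.
have [_ _ dom] := hit v' (Vcol _ vV').
case/orP => [lt|/andP[/eqP xx' lexL]]; last first.
  have [_ _ _ lexf] := hV' _ vV.
  rewrite -xE -xE'; apply: lexf => //; first by move: xG'; rewrite -xi' -xx' xi.
  rewrite -(@eq_lex L x x') // => j; rewrite LS => jS'.
  have [/andP[? _] /andP[? _]] := (xlt j jS', xlt' j jS').
  by rewrite /unshift jS' eqn_sub2rE // ltn_sub2rE.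
have next u u' : u < u' -> u * s + s.-1 < u' * s.
  by move=> uu'; apply: (@leq_trans (u.+1 * s)); rewrite ?leq_mul2r ?uu' ?orbT // mulSn; lia.
have ltv : v < v' by move: lt; rewrite xi xi' ltn_pmul2r // ltn_add2r ltn_pmul2r.
apply: (@lt_le_trans _ _
  (f (put (upd (fun j => nat_of_ord (kappa j)) i v') (upd (fun j => (a j).+1) i 0)))).
  apply: incf.
  - move=> j jS; rewrite /put jS; case: (eqVneq j i) => [->|ji].
      rewrite !upd_same xi put_lt // andbT leq_mul2r; apply/orP; right.
      by rewrite addn0 ltnW // next.
    rewrite !upd_other // put_lt // andbT.
    have /andP[_ /ltnW xj] := xlt j (S'S j jS ji).
    by apply: leq_trans xj _; rewrite /off addnS mulSn addnC.
  - move=> j jS; have [-> _] := off_grid j jS.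
    by rewrite /put (negbTE jS).
  - exists i; rewrite // /put iS !upd_same xi /top ltn_pmul2r //.
    by rewrite addn0 next.
apply: le_trans (ltW dom) _; apply: (increasing_on_le incf).
- move=> j jS; rewrite /put jS; case: (eqVneq j i) => [->|ji].
    by rewrite !upd_same xi' leqnn top_lt.
  rewrite !upd_other //; have /andP[le xj] := xlt' j (S'S j jS ji).
  rewrite le /=; have := gx' j; rewrite jS /G' (negbTE ji) => /mapP[g gG ->].
  by apply: off_lt; have [_ _ /allP] := GP j; apply.
- move=> j jS; have [_ ->] := off_grid j jS.
  by rewrite /put (negbTE jS).
Qed.

(** The trivial bound [(n * q) ^ n] would cost a factor [n ^ n] when [q] is
bounded, and with it the exponent [n] of the family in dimension two. The factor
disappears because [n ^ n <= 'C(2 * n, n) * n`!]. *)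
Lemma bin_mul_le n q : 'C(n * q, n) <= (4 * q) ^ n.
Proof.
have ffact_le m k : m ^_ k <= m ^ k.
  rewrite ffact_prod -[k in leqRHS]card_ord -prod_nat_const.
  by apply: leq_prod => i _; exact: leq_subr.
have le_ffact : n ^ n <= (2 * n) ^_ n.
  rewrite ffact_prod -[X in _ ^ X]card_ord -prod_nat_const.
  by apply: leq_prod => i _; have := ltn_ord i; lia.
have bin4 : 'C(2 * n, n) <= 4 ^ n.
  have -> : 4 ^ n = (1 + 1) ^ (2 * n) by rewrite expnM.
  have n2 : n < (2 * n).+1 by lia.
  rewrite expnDn (bigD1 (Ordinal n2)) //= !exp1n !muln1.
  exact: leq_addr.
rewrite -(@leq_pmul2r n`!) ?fact_gt0 // bin_ffact.
apply: leq_trans (ffact_le _ _) _; rewrite !expnMn mulnAC leq_mul2r.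
apply/orP; right; apply: leq_trans le_ffact _.
by rewrite -bin_ffact leq_mul2r bin4 orbT.
Qed.

Lemma leq_2exp n : n <= 2 ^ n.
Proof. exact: ltnW (ltn_expl _ _). Qed.

Lemma card_extension_index n s B (T : finType) :
  #|extension_index n s B T| = #|I| * s ^ #|I| * B ^ #|I| * 'C(B, n) * #|T|.
Proof.
rewrite !card_prod !card_ffun !card_ord card_sig.
by rewrite -(card_ltn_sorted_tuples n B) cardsE.
Qed.

(** The side in dimension [k.+1] exceeds the one in dimension [k] by a factor of
the order of [n] times the size of the family in dimension [k], whence an
exponent one less than that of the family; in dimensions one and two the side is
polynomial in [n], which [2 ^ (A * n)] covers. *)
Lemma lex_family_exists (k : nat) : exists A, forall n, 0 < n ->
  exists N (T : finType) (fam : {set I} -> T -> (I -> seq nat) * seq I),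
    [/\ 0 < N, 0 < #|T|, #|T| <= 2 ^ (A * n ^ k),
        N <= 2 ^ (A * n ^ maxn 1 k.-1) & lex_family n N k.+1 fam].
Proof.
elim: k => [|k [A IHk]].
  exists 1 => n n0.
  exists n, unit, (fun S _ => (fun=> iota 0 n, enum S)).
  split; last exact: lex_family1.
  - by [].
  - by rewrite card_unit.
  - by rewrite card_unit expn_gt0.
  - by rewrite mul1n leq_2exp.
pose s := (2 * #|I|).+1; pose Q := #|I| * s ^ #|I|.
exists (Q + (Q + 1 + A) * #|I| + (2 + Q + A) + A + Q + 1 + A + s + A) => n n0.
case: (posnP #|I|) => [I0|I0].
  exists 1, unit, (fun _ _ => (fun=> [::], [::])); split=> //.
  - by rewrite card_unit.
  - by rewrite card_unit expn_gt0.
  - by rewrite expn_gt0.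
  - by move=> S y f cS; have := max_card (mem S); rewrite cS I0.
have [N [T [fam [N0 T0 TA NA famP]]]] := IHk n n0.
set P := n ^ k in TA.
have P0 : 0 < P by rewrite expn_gt0 n0.
have [B BE] : exists B, B = Q * (n * #|T|) by exists (Q * (n * #|T|)).
have Q0 : 0 < Q by rewrite /Q muln_gt0 I0 expn_gt0.
have B0 : 0 < B by rewrite BE !muln_gt0 I0 expn_gt0 n0.
have Bn : n <= B by rewrite BE mulnCA leq_pmulr // muln_gt0 Q0 T0.
have BA : B <= 2 ^ (Q + n + A * P).
  rewrite BE !expnD -mulnA; apply: leq_mul (leq_2exp _) _.
  by apply: leq_mul TA; exact: leq_2exp.
exists (B * s * N), (extension_index n s B T), (@extend_family n s B N T fam).
split.
- by rewrite muln_gt0 N0 [0 < B * s]muln_gt0 B0.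
- by rewrite card_extension_index !muln_gt0 !expn_gt0 bin_gt0 I0 B0 Bn T0.
- rewrite card_extension_index -/Q.
  have binA : 'C(B, n) <= 2 ^ ((2 + Q + A * P) * n).
    rewrite BE mulnCA; apply: leq_trans (bin_mul_le _ _) _.
    have QT : Q * #|T| <= 2 ^ Q * 2 ^ (A * P) by exact: leq_mul (leq_2exp _) TA.
    by rewrite expnM leq_exp2r // -addnA expnD leq_mul2l expnD QT orbT.
  have BdA : B ^ #|I| <= 2 ^ ((Q + n + A * P) * #|I|).
    by rewrite expnM; case: #|I| => // d; rewrite leq_exp2r.
  apply: leq_trans (leq_mul (leq_mul (leq_mul (leq_2exp Q) BdA) binA) TA) _.
  rewrite -!expnD leq_exp2l // expnS -/P.
  have nP : n <= n * P by rewrite leq_pmulr.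
  have Pn : P <= n * P by rewrite leq_pmull.
  have X0 m : m <= m * (n * P) by rewrite leq_pmulr // muln_gt0 n0.
  move: (n * P) X0 nP Pn (mulnC P n) => X X0 nX PX PnE.
  have h1 : Q + n + A * P <= (Q + 1 + A) * X.
    by rewrite !mulnDl mul1n !leq_add // leq_mul2l PX orbT.
  have h2 : (2 + Q + A * P) * n <= (2 + Q + A) * X.
    by rewrite !mulnDl -mulnA PnE leq_add2r leq_add // leq_mul2l nX orbT.
  have h3 : A * P <= A * X by rewrite leq_mul2l PX orbT.
  have h4 : (Q + n + A * P) * #|I| <= (Q + 1 + A) * #|I| * X.
    by rewrite mulnAC leq_mul2r h1 orbT.
  apply: leq_trans (leq_add (leq_add (leq_add (X0 Q) h4) h2) h3) _.
  rewrite -!mulnDl leq_mul2r; apply/orP; right.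
  by move: (Q) (s) ((Q + 1 + A) * #|I|); clear => q r U; lia.
- rewrite /=.
  have [nY PY ZY] : [/\ n <= n ^ maxn 1 k, P <= n ^ maxn 1 k &
      n ^ maxn 1 k.-1 <= n ^ maxn 1 k].
    rewrite /P -[X in X <= _]expn1; split; rewrite leq_pexp2l //; lia.
  have Y0 m : m <= m * n ^ maxn 1 k by rewrite leq_pmulr // expn_gt0 n0.
  move: (n ^ maxn 1 k) (n ^ maxn 1 k.-1) Y0 nY PY ZY NA => Y Z Y0 nY PY ZY NA.
  apply: leq_trans (leq_mul (leq_mul BA (leq_2exp s)) NA) _.
  rewrite -!expnD leq_exp2l //.
  have h1 : Q + n + A * P <= (Q + 1 + A) * Y.
    by rewrite !mulnDl mul1n !leq_add // leq_mul2l PY orbT.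
  have h2 : A * Z <= A * Y by rewrite leq_mul2l ZY orbT.
  apply: leq_trans (leq_add (leq_add h1 (Y0 s)) h2) _.
  rewrite -!mulnDl leq_mul2r; apply/orP; right.
  by move: (Q) (s) ((Q + 1 + A) * #|I|); clear => q r U; lia.
- by rewrite BE; exact: extend_lex_family.
Qed.
End Lexicographic.

(** * The tower of exponentials *)

Lemma mono_size_le d m l : 0 < d -> 0 < m ->
  mono_size d (2 ^ d) m l <= 2 ^ ((3 * d * m) ^ l.+1).
Proof.
move=> d0 m0; elim: l => [|l IHl] /=.
  rewrite expn1; apply: leq_trans (leq_2exp _) _.
  by rewrite leq_exp2l // leq_pmull // muln_gt0.
set X := (3 * d * m) ^ l.+1 in IHl *.
have X0 : 0 < X by rewrite expn_gt0 !muln_gt0 d0 m0.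
apply: (@leq_trans (2 ^ (m + d + X * m * d))).
  rewrite 2!expnD; apply: leq_mul; first by rewrite leq_mul2r leq_2exp orbT.
  by rewrite !expnM leq_exp2r // leq_exp2r.
rewrite leq_exp2l // expnS -/X.
have -> : 3 * d * m * X = m * d * X + d * m * X + X * m * d by nia.
by rewrite !leq_add // -mulnA leq_pmulr // muln_gt0 ?d0 ?m0.
Qed.

Lemma end_hom_size_le d K l : 0 < d -> 0 < K ->
  end_hom_size d K l <= 2 ^ ((2 * d * K) ^ (d.+1 + l)).
Proof.
move=> d0 K0; have b0 : 0 < 2 * d * K by rewrite !muln_gt0 d0.
elim: l => [|l IHl] /=.
  apply: leq_trans (leq_2exp _) _; rewrite leq_exp2l //.
  by rewrite addn0 expnS -mulnA (leq_trans (leq_pmulr K _) (leq_pmull _ _)) ?expn_gt0 ?b0 // muln_gt0.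
set X := (2 * d * K) ^ (d.+1 + l) in IHl *.
have KX : K ^ d * K <= X.
  rewrite -expnSr; apply: (@leq_trans ((2 * d * K) ^ d.+1)).
    by rewrite leq_exp2r // leq_pmull // muln_gt0.
  by rewrite leq_pexp2l // leq_addr.
apply: (@leq_trans (2 ^ (K ^ d * K + X * K * d))).
  rewrite expnD; apply: leq_mul; first by rewrite -expnM.
  by rewrite !expnM leq_exp2r // leq_exp2r.
rewrite leq_exp2l // addnS expnS -/X.
have -> : 2 * d * K * X = d * K * X + X * K * d by nia.
by rewrite leq_add2r (leq_trans KX) // leq_pmull // muln_gt0 d0.
Qed.

(** Since [m] is already exponential, polynomials in [m] only affect the constant
of the innermost exponent. *)
Lemma tower_bound d e A : 0 < d -> exists C, forall n m, 0 < n -> 0 < m ->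
  m <= 2 ^ (A * n ^ e) ->
  end_hom_size d (mono_size d (2 ^ d) m d) d <= 2 ^ (2 ^ (2 ^ (C * n ^ e))).
Proof.
move=> d0; exists (4 * d + 2 + (3 * d + A) * d.+1) => n m n0 m0 mA.
set X := n ^ e in mA *.
have X0 : 0 < X by rewrite expn_gt0 n0.
set K := mono_size _ _ _ _.
have K0 : 0 < K by apply: mono_size_gt0; rewrite ?expn_gt0.
apply: leq_trans (end_hom_size_le _ d0 K0) _; rewrite leq_exp2l //.
pose u := (3 * d * m) ^ d.+1; pose w := (3 * d + A * X) * d.+1.
have uw : u <= 2 ^ w.
  rewrite /u /w expnM leq_exp2r // expnD.
  by apply: leq_mul mA; exact: leq_2exp.
have KU : 2 * d * K <= 2 ^ (2 * d + u).
  rewrite expnD; apply: leq_mul (leq_2exp _) _.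
  exact: mono_size_le.
apply: (@leq_trans (2 ^ ((2 * d + u) * (d.+1 + d)))).
  by rewrite expnM leq_exp2r // addSn.
rewrite leq_exp2l //; apply: (@leq_trans (2 ^ (2 * d + w + 1 + (d.+1 + d)))).
  rewrite [leqRHS]expnD; apply: leq_mul (leq_2exp _).
  rewrite addn1 expnS [leqRHS]mul2n -addnn; apply: leq_add.
    by apply: leq_trans (leq_2exp _) _; rewrite leq_exp2l // leq_addr.
  by apply: leq_trans uw _; rewrite leq_exp2l // leq_addl.
rewrite leq_exp2l // /w.
have h : (3 * d + A * X) * d.+1 <= (3 * d + A) * d.+1 * X.
  by rewrite mulnAC leq_mul2r mulnDl leq_add2r leq_pmulr.
rewrite [leqRHS]mulnDl.
have h2 : 4 * d + 2 <= (4 * d + 2) * X by rewrite leq_pmulr.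
apply: leq_trans (leq_add h2 h).
by move: ((3 * d + A * X) * d.+1) => v; lia.
Qed.

(** * Arrays on integer boxes *)

Local Open Scope classical_set_scope.
Local Open Scope ring_scope.

Definition lattice_point (d : nat) (x : 'I_d -> nat) : {ffun 'I_d -> int} :=
  [ffun i => (x i).+1%:Z].

(** On the monotone subarray, reversing the order of the values in the decreasing
directions makes all directions increase, and the family applies. The reversed
directions become the negative signs, and the order in which the coordinates
dominate becomes the permutation. *)
Lemma lex_unavoidable_of_family (R : realType) (d n m : nat) (T : finType)
    (fam : {set 'I_d} -> T -> ('I_d -> seq nat) * seq 'I_d) :
  (0 < d)%N -> (0 < n)%N -> (0 < m)%N -> lex_family R n m d fam ->
  lex_unavoidable R d n
    (end_hom_size #|'I_d| (mono_size #|'I_d| (2 ^ #|'I_d|) m #|'I_d|) #|'I_d|).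
Proof.
move=> d0 n0 m0 famP; set N := end_hom_size _ _ _.
split.
  rewrite /N card_ord; case: d d0 {N fam famP} => // d _.
  have K0 : (0 < mono_size d.+1 (2 ^ d.+1) m d.+1)%N.
    by apply: mono_size_gt0; rewrite ?expn_gt0.
  exact: leq_trans K0 (end_hom_size_ge _ _ K0).
move=> f fN.
pose g x := f (lattice_point x).
have g_inj x x' : (forall i, (x i < N)%N) -> (forall i, (x' i < N)%N) ->
    g x = g x' -> x = x'.
  move=> xN x'N ee.
  have inN z : (forall i, (z i < N)%N) -> lattice_point z \in box (sides f).
    by move=> zN; rewrite inE => i; rewrite fN ffunE /=; have := zN i; lia.
  have /ffunP c := array_inj (inN x xN) (inN x' x'N) ee.
  by apply: funext => i; have := c i; rewrite !ffunE => -[].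
have [G [sigma [GP dirG]]] :=
  @homogeneous_directions 'I_d m (fun x x' => g x < g x') m0.
rewrite -/N in GP.
have szG i : size (G i) = m by have [] := GP i.
pose e i k := nth 0%N (G i) (if sigma i then k else m.-1 - k)%N.
have e_idx i k : (k < m)%N -> ((if sigma i then k else m.-1 - k) < m)%N.
  by move=> km; case: ifP => _ //; lia.
have eG i k : (k < m)%N -> e i k \in G i by move=> km; rewrite mem_nth // szG e_idx.
have eN i k : (k < m)%N -> (e i k < N)%N.
  by move=> km; have [_ _ /allP] := GP i; apply; exact: eG.
have e_lt i k k' : (k < m)%N -> (k' < m)%N -> (k < k')%N ->
    if sigma i then (e i k < e i k')%N else (e i k' < e i k)%N.
  move=> km k'm kk'; have [sG _ _] := GP i; rewrite /e.
  by case: (sigma i); apply: (sorted_ltn_nth ltn_trans 0%N sG); rewrite ?inE ?szG; lia.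
pose h x := g (fun i => e i (x i)).
have inc_h : increasing_on [set: 'I_d]%SET m (fun=> 0%N) h.
  apply: increasing_on_steps => i x x' xm x'm ex lt.
  have := e_lt i _ _ (xm i) (x'm i) lt.
  have ex' j : j != i -> e j (x' j) = e j (x j) by move=> /ex ->.
  case si : (sigma i) => le_e.
    rewrite /h; apply: etrans (dirG i _ _ _ _ _ _) si => //.
    - by move=> j; exact: eG.
    - exact: eG.
  have nlt : (h x' < h x) = false.
    rewrite /h; apply: etrans (dirG i _ _ _ _ _ _) si => //.
    - by move=> j; exact: eG.
    - exact: eG.
    - by move=> j /ex'.
  rewrite lt_neqAle leNgt nlt andbT; apply/eqP => /g_inj e_eq.
  have /(congr1 (fun z => z i)) := e_eq (fun j => eN _ _ (xm j)) (fun j => eN _ _ (x'm j)).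
  by move=> e_i; rewrite e_i ltnn in le_e.
have cardT : #|[set: 'I_d]%SET| = d by rewrite cardsT card_ord.
have [t] := famP [set: 'I_d]%SET (fun=> 0%N) h cardT inc_h.
case: (fam _ t) => H L [HP uL LT lexh].
have szH i : size (H i) = n by have [] := HP i.
have Hm i k : k \in H i -> (k < m)%N by have [_ _ /allP] := HP i; apply.
have e_mono i k k' : (k < m)%N -> (k' < m)%N ->
    ((if sigma i then 1 else -1) * (e i k).+1%:Z < (if sigma i then 1 else -1) * (e i k').+1%:Z)
    = (k < k')%N.
  move=> km k'm; case: (ltngtP k k') => [lt|gt|->]; last by rewrite ltxx.
    by have := e_lt i k k' km k'm lt; case: (sigma i); lia.
  by have := e_lt i k' k k'm km gt; case: (sigma i); lia.
have e_inj i k k' : (k < m)%N -> (k' < m)%N -> e i k = e i k' -> k = k'.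
  move=> km k'm ekk'; have := e_mono i k k' km k'm; have := e_mono i k' k k'm km.
  by rewrite ekk' ltxx; lia.
pose B i : set int := [set (e i k).+1%:Z | k in [set k | k \in H i]].
have Bf i : B i `<=` sides f i.
  move=> _ [k /= /Hm km <-]; rewrite fN /=; have := eN i k km; lia.
have B0 i : B i !=set0.
  exists (e i (nth 0%N (H i) 0)).+1%:Z; exists (nth 0%N (H i) 0) => //=.
  by rewrite mem_nth // szH.
have B_inj : {in box B &, injective f}.
  move=> x x'; rewrite !inE => xB x'B; apply: array_inj; rewrite inE => i.
    exact: Bf.
  exact: Bf.
exists (Array B0 B_inj); split.
- by split.
- move=> i; rewrite /=; pose b r := (e i (nth 0%N (H i) r)).+1%:Z.
  have -> : B i = b @` `I_n.
    apply/seteqP; split=> [_ [k /= kH <-]|_ [r /= rn <-]].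
      by exists (index k (H i)); rewrite /= ?/b ?nth_index // -(szH i) index_mem.
    by exists (nth 0%N (H i) r) => //=; rewrite mem_nth // szH.
  apply: inj_card_eq => r r'; rewrite !inE /= /b => rn r'n [] ee.
  have [sH _ _] := HP i.
  apply/eqP; rewrite -(nth_uniq 0%N (s := H i)) ?szH //; last first.
    by apply: sorted_uniq sH; [exact: ltn_trans|exact: ltnn].
  by apply/eqP; apply: (e_inj i) ee; apply: (Hm i); rewrite mem_nth // szH.
have szL : size L = d.
  by rewrite -(card_uniqP uL); apply: etrans cardT; apply: eq_card => j; rewrite LT.
pose i0 : 'I_d := Ordinal d0.
have tau_inj : injective (fun r : 'I_d => nth i0 L r).
  by move=> r r' /eqP; rewrite nth_uniq ?szL // => /eqP/val_inj.
exists (perm tau_inj), (fun i => if sigma i then 1 else -1); split.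
  by move=> i; case: ifP; [right|left].
move=> x y; rewrite !inE /= => xB yB.
have coord z : box B z -> exists k, [/\ forall i, k i \in H i,
    z = lattice_point (fun i => e i (k i)) & f z = h k].
  move=> zB; have /choice[k kP] i : exists k, k \in H i /\ (e i k).+1%:Z = z i.
    by have [k kH kz] := zB i; exists k.
  have zk : z = lattice_point (fun i => e i (k i)).
    by apply/ffunP => i; rewrite ffunE (proj2 (kP i)).
  exists k; split; rewrite ?zk //; first by move=> i; exact: (proj1 (kP i)).
have [kx [xH xE fx]] := coord x xB.
have [ky [yH yE fy]] := coord y yB.
have gridk k : (forall i, k i \in H i) -> grid [set: 'I_d]%SET H (fun=> 0%N) k.
  by move=> kH i; rewrite finset.in_setT.
have lex_f : f x < f y <-> lex L kx ky.
  rewrite fx fy; split; last by apply: lexh; exact: gridk.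
  case: (lex_total L kx ky) => [//|/lexh gt|eqL].
    by move=> lt; have := lt_trans lt (gt (gridk _ yH) (gridk _ xH)); rewrite ltxx.
  suff -> : kx = ky by rewrite ltxx.
  by apply: funext => i; apply: eqL; rewrite LT finset.in_setT.
rewrite lex_f (lexP i0); split.
- case=> r rL [lt eqr]; rewrite szL in rL; exists (Ordinal rL); split.
    by move=> j jr; rewrite !permE xE yE !ffunE eqr.
  by rewrite !permE xE yE !ffunE e_mono // (Hm _ _ (xH _), Hm _ _ (yH _)).
- case=> r [eqr]; rewrite !permE xE yE !ffunE e_mono ?(Hm _ _ (xH _)) ?(Hm _ _ (yH _)) //.
  move=> lt; exists (r : nat); first by rewrite szL.
  split=> // r' r'r; have r'd : (r' < d)%N by exact: ltn_trans r'r _.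
  have := eqr (Ordinal r'd) r'r; rewrite !permE xE yE !ffunE /= => eqe.
  set j := nth i0 L r' in eqe *.
  have := e_mono j _ _ (Hm _ _ (xH j)) (Hm _ _ (yH j)).
  have := e_mono j _ _ (Hm _ _ (yH j)) (Hm _ _ (xH j)).
  by rewrite eqe ltxx; lia.
Qed.

Lemma powR_nat2 (R : realType) (k : nat) : (2 : R) `^ k%:R = (2 ^ k)%:R.
Proof. by rewrite powR_mulrn // natrX. Qed.

Theorem mainTheorem4 (R : realType) (d : nat) (hd : (3 <= d)%N) :
  exists C : R, 0 < C /\
    forall n : nat, (0 < n)%N ->
      exists N : nat, is_L R d n N /\
        N%:R <= 2 `^ (2 `^ (2 `^ (C * n%:R ^+ (d - 2)))).
Proof.
have d0 : (0 < d)%N by lia.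
have [A famA] := @lex_family_exists 'I_d _ R d.-1.
have [C bound] := tower_bound (d - 2) A d0.
exists C.+1%:R; split; first by rewrite ltr0n.
move=> n n0; have [m [T [fam [m0 _ _ mA famP]]]] := famA n n0.
rewrite prednK // in famP.
have unav := lex_unavoidable_of_family d0 n0 m0 famP; rewrite card_ord in unav.
have exN : exists N, `[< lex_unavoidable R d n N >] by eexists; apply/asboolP; exact: unav.
case: (ex_minnP exN) => N /asboolP NP Nmin.
exists N; split.
  by split=> // M MP; apply: Nmin; apply/asboolP.
have -> : C.+1%:R * n%:R ^+ (d - 2) = (C.+1 * n ^ (d - 2))%:R :> R.
  by rewrite natrM natrX.
rewrite !powR_nat2 ler_nat.
have le_N := Nmin _ (introT (asboolP _) unav); apply: leq_trans le_N _.
apply: leq_trans (bound n m n0 m0 _) _.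
  by move: mA; have -> : maxn 1 d.-1.-1 = (d - 2)%N by lia.
by rewrite !leq_exp2l // leq_mul2r leqnSn orbT.
Qed.
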